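(* Let $E,F$ be Riesz spaces with $F$ Archimedean. Then the following assertions are equivalent. (1) $\mathcal{P}(E,F) = \mathcal{O}(E,F)$. (2) Either $F = \{0\}$ or for every $e \in E$ the set $\mathfrak{F}_e$ is finite.
   Context: A Riesz space is a real vector lattice; $x \perp y$ (disjointness) means $|x| \wedge |y| = 0$. For a Riesz space $E$ and $x,y\in E$, $x$ is called a fragment of $y$, written $x \sqsubseteq y$, if $x \perp y - x$. For $e \in E$, $\mathfrak{F}_e$ denotes the set of all fragments of $e$. A function $T \colon E \to F$ between Riesz spaces is an orthogonally additive operator (OAO) if $T(x+y) = T(x) + T(y)$ for all disjoint $x,y \in E$; $\mathcal{O}(E,F)$ is the set of all OAOs from $E$ to $F$. An OAO $T \colon E \to F$ is laterally-to-order bounded if for every $e \in E$ the set $T(\mathfrak{F}_e)$ is order bounded in $F$; $\mathcal{P}(E,F)$ is the set of all laterally-to-order bounded OAOs from $E$ to $F$. *)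

(* Defs.v *)
From HB Require Import structures.
From mathcomp Require Import all_boot all_order all_algebra.
From mathcomp Require Import boolp classical_sets functions cardinality reals.

Set Implicit Arguments.
Unset Strict Implicit.
Unset Printing Implicit Defensive.

Import Order.TTheory GRing.Theory Num.Theory.

Local Open Scope classical_set_scope.
Local Open Scope ring_scope.

(* The lattice operations are fields, with the laws of [Order.meet] and
   [Order.join]: the library's lattices and its additive structures are
   already joined by [realDomainType], so that HB rejects a later, weaker
   structure inheriting from both.  The instances below give every
   Riesz space its library lattice structure. *)
HB.mixin Record isRiesz (R : realType) E
    of Order.POrder ring_display E & GRing.Lmodule R E := {
  riesz_meet : E -> E -> E ;
  riesz_join : E -> E -> E ;
  riesz_lexI : forall x y z : E,
    (x <= riesz_meet y z) = (x <= y) && (x <= z) ;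
  riesz_leUx : forall x y z : E,
    (riesz_join x y <= z) = (x <= z) && (y <= z) ;
  riesz_lerD2r : forall x y z : E, x <= y -> x + z <= y + z ;
  riesz_scaler_ge0 : forall (a : R) (x : E), 0 <= a -> 0 <= x -> 0 <= a *: x
}.

#[short(type="rieszType")]
HB.structure Definition Riesz (R : realType) :=
  { E of Order.POrder ring_display E & GRing.Lmodule R E & isRiesz R E }.

HB.instance Definition _ (R : realType) (E : rieszType R) :=
  Order.POrder_isMeetSemilattice.Build ring_display (Riesz.sort E)
    (@riesz_lexI R E).
HB.instance Definition _ (R : realType) (E : rieszType R) :=
  Order.POrder_isJoinSemilattice.Build ring_display (Riesz.sort E)
    (@riesz_leUx R E).

(* The library norm is valued in a scalar ring, hence this E-valued modulus. *)
Definition modulus (R : realType) (E : rieszType R) (x : E) : E :=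
  Order.join x (- x).

Definition disjoint (R : realType) (E : rieszType R) (x y : E) : Prop :=
  Order.meet (modulus x) (modulus y) = 0.

Definition fragment (R : realType) (E : rieszType R) (x y : E) : Prop :=
  disjoint x (y - x).

Definition fragments (R : realType) (E : rieszType R) (e : E) : set E :=
  [set x | fragment x e].

Definition archimedean (R : realType) (F : rieszType R) : Prop :=
  forall x y : F, 0 <= x -> (forall n : nat, x *+ n <= y) -> x = 0.

Definition order_bounded (R : realType) (F : rieszType R) (A : set F) : Prop :=
  has_lbound A /\ has_ubound A.

Definition OAO (R : realType) (E F : rieszType R) : set (E -> F) :=
  [set T | forall x y : E, disjoint x y -> T (x + y) = T x + T y].

Definition laterally_to_order_bounded (R : realType) (E F : rieszType R)
    (T : E -> F) : Prop :=
  forall e : E, order_bounded (T @` fragments e).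

Definition lobOAO (R : realType) (E F : rieszType R) : set (E -> F) :=
  [set T | OAO T /\ laterally_to_order_bounded T].

Arguments OAO {R} E F.
Arguments lobOAO {R} E F.

(* Main.v *)
Require Import Defs.
From HB Require Import structures.
From mathcomp Require Import all_boot all_order all_algebra.
From mathcomp Require Import boolp classical_sets functions cardinality reals.

(* If [e] has infinitely many fragments, repeated splitting produces a sequence
   [d] of nonzero pairwise disjoint fragments of [e].  Such a sequence is
   linearly independent in [E], so Zorn's lemma gives a linear functional [phi]
   with [phi (d n) = n].  Linear maps are orthogonally additive, and for [f <> 0]
   in the Archimedean space [F] the map [x |-> phi x *: |f|] is unbounded on the
   fragments of [e]. *)

Import Order.TTheory GRing.Theory Num.Theory.

Local Open Scope classical_set_scope.
Local Open Scope ring_scope.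

Local Notation disjoint := Defs.disjoint.

(** * Extension of partial linear functionals *)

Section LinearExtension.
Variables (K : fieldType) (V : lmodType K).
Implicit Types (G : set (V * K^o)).

(** A partial linear functional, encoded as its graph so that Zorn's lemma applies to inclusion. By
    subtraction, single-valuedness reduces to the fibre over 0. *)
Definition linear_graph G : Prop :=
  [/\ forall k a b, G a -> G b -> G (k *: a + b)
    & forall r, G (0, r) -> r = 0].

(** A maximal linear graph above [G] is total: a point outside its domain could be adjoined. *)
Lemma linear_graph_extend (G : set (V * K^o)) :
  linear_graph G -> G 0 ->
  exists phi : V -> K,
    (forall k x y, phi (k *: x + y) = k * phi x + phi y) /\
    (forall x r, G (x, r) -> phi x = r).
Proof.
move=> linG G0.
(* [A = set0] is allowed because Zorn_bigcup also ranges over the empty chain. *)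
pose P (A : set (V * K^o)) := A = set0 \/ (G `<=` A /\ linear_graph A).
have [A [PA maxA]] : exists A, P A /\ forall B, A `<` B -> ~ P B.
  apply: Zorn_bigcup => F FP totF.
  have [Fne|F0] := pselect (exists2 X, F X & X !=set0); last first.
    left; rewrite -subset0 => z [X FX Xz]; case: F0; exists X => //; by exists z.
  right; case: Fne => X FX [x Xx].
  have PX Y y : F Y -> Y y -> G `<=` Y /\ linear_graph Y.
    by move=> /FP[->//|].
  split; first by move=> y Gy; exists X => //; apply: (PX X x FX Xx).1.
  split=> [k a b [Y FY Ya] [Z FZ Zb]|r [Y FY Yr]]; last first.
    by have [_ [_]] := PX _ _ FY Yr; apply.
  have [YZ|ZY] := totF _ _ FY FZ.
    by exists Z => //; have [_ [+ _]] := PX _ _ FZ Zb; apply=> //; apply: YZ.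
  by exists Y => //; have [_ [+ _]] := PX _ _ FY Ya; apply=> //; apply: ZY.
have {PA}[GA [linA funA]] : G `<=` A /\ linear_graph A.
  case: PA => // A0; case: (maxA G); last by right; split.
  by rewrite A0; split=> [|/(_ _ G0)]; [exact: sub0set|].
have A0 : A 0 by apply: GA.
have AB a b : A a -> A b -> A (a - b).
  by move=> Aa Ab; rewrite addrC -scaleN1r; apply: linA.
have AZ k a : A a -> A (k *: a) by move=> Aa; rewrite -[_ *: _]addr0; apply: linA.
have totA x : exists r, A (x, r).
  apply: contrapT => nx.
  (* [B] extends [A] to the span of its domain and [x], with the arbitrary value 0 at [x]. *)
  pose B : set (V * K^o) := [set z | exists a k, A a /\ z = k *: (x, 0) + a].
  apply: (maxA B).
    split=> [|BA]; first by move=> a Aa; exists a, 0; rewrite scale0r add0r.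
    by apply: nx; exists 0; apply: BA; exists 0, 1; rewrite scale1r addr0.
  right; split; first by move=> a /GA Aa; exists a, 0; rewrite scale0r add0r.
  split=> [k _ _ [a [i [Aa ->]]] [b [j [Ab ->]]]|r [a [k [Aa]]]].
    exists (k *: a + b), (k * i + j); split; first exact: linA.
    by rewrite scalerDr scalerA scalerDl addrACA.
  (* Single-valuedness of [B]: if [k] is nonzero, then [x] equals [- k^-1 *: a1], which lies in the
     domain of [A], against [nx]. *)
  case: a Aa => a1 a2 Aa; have [->|k0] := eqVneq k 0.
    by rewrite scale0r add0r => -[a10 ->]; apply: funA; rewrite a10.
  case=> /eqP; rewrite eq_sym addrC addr_eq0 => /eqP a1E _; case: nx.
  exists (- k^-1 *: a2); have := AZ (- k^-1) _ Aa.
  congr (A (_, _)); rewrite /= a1E scaleNr scalerN opprK scalerA.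
  by rewrite mulVf ?scale1r.
have [phi phiP] := choice totA.
have funA2 x r s : A (x, r) -> A (x, s) -> r = s.
  move=> Ar As; apply/eqP; rewrite -subr_eq0; apply/eqP/funA.
  by have := AB _ _ Ar As; congr (A (_, _)); apply: subrr.
exists phi; split=> [k x y|x r /GA]; last exact: funA2.
by apply: (funA2 (k *: x + y)) => //; apply: linA (phiP x) (phiP y).
Qed.

(** The pairs [(v i, c i)] span a linear graph; freeness of [v] is what makes it single-valued. *)
Lemma linear_extend_free (v : nat -> V) (c : nat -> K) :
  (forall n (a : nat -> K), \sum_(i < n) a i *: v i = 0 ->
     forall i, (i < n)%N -> a i = 0) ->
  exists phi : V -> K,
    (forall k x y, phi (k *: x + y) = k * phi x + phi y) /\
    (forall n, phi (v n) = c n).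
Proof.
move=> freev; pose w i : V * K^o := (v i, c i).
(* Coefficients vanish from [n] on, so that two combinations can be rewritten with a common length
   before they are added. *)
pose G : set (V * K^o) := [set z | exists n (a : nat -> K),
  (forall i, (n <= i)%N -> a i = 0) /\ z = \sum_(i < n) a i *: w i].
have widen n m (a : nat -> K) : (forall i, (n <= i)%N -> a i = 0) ->
    (n <= m)%N -> \sum_(i < n) a i *: w i = \sum_(i < m) a i *: w i.
  move=> a0 nm; rewrite (big_ord_widen _ (fun i => a i *: w i) nm) big_mkcond.
  by apply: eq_bigr => i _; case: ltnP => // /a0 ->; rewrite scale0r.
have sumE n (a : nat -> K) : \sum_(i < n) a i *: w i =
    (\sum_(i < n) a i *: v i, \sum_(i < n) a i * c i).
  by elim: n => [|n IHn]; rewrite ?big_ord0// !big_ord_recr /= IHn.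
have [||phi [phil phiG]] := @linear_graph_extend G.
- split=> [k _ _ [n [a [a0 ->]]] [m [b [b0 ->]]]|r [n [a [a0]]]].
    exists (maxn n m), (fun i => k * a i + b i); split=> [i|].
      by rewrite geq_max => /andP[/a0-> /b0->]; rewrite mulr0 addr0.
    rewrite (widen n (maxn n m)) ?leq_maxl// (widen m (maxn n m)) ?leq_maxr//.
    rewrite scaler_sumr -big_split /=; apply: eq_bigr => i _.
    by rewrite scalerDl scalerA.
  rewrite sumE => -[e ->]; rewrite big1// => i _.
  by rewrite (freev n)// mul0r.
- by exists 0%N, (fun=> 0); rewrite big_ord0.
exists phi; split=> // n; apply: phiG.
exists n.+1, (fun i => (i == n)%:R); split=> [i|].
  by case: eqVneq => // ->; rewrite ltnn.
rewrite big_ord_recr/= eqxx scale1r big1 ?add0r// => i _.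
by rewrite ltn_eqF ?scale0r.
Qed.

End LinearExtension.

(** * Order arithmetic and the modulus in a Riesz space *)

Section RieszTheory.
Variables (R : realType) (E : rieszType R).
Implicit Types x y z a b c e : E.

Lemma riesz_lerD2r_iff z x y : (x + z <= y + z) = (x <= y).
Proof.
apply/idP/idP => [/(riesz_lerD2r _ _ (- z))|]; last exact: riesz_lerD2r.
by rewrite !addrK.
Qed.

Lemma riesz_lerD x y a b : x <= y -> a <= b -> x + a <= y + b.
Proof.
move=> xy ab; apply: (@le_trans _ _ (y + a)); first exact: riesz_lerD2r.
by rewrite ![y + _]addrC riesz_lerD2r.
Qed.

Lemma riesz_lerBlDr x y z : (x - y <= z) = (x <= z + y).
Proof. by rewrite -(riesz_lerD2r_iff y (x - y)) subrK. Qed.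

Lemma riesz_subr_ge0 x y : (0 <= y - x) = (x <= y).
Proof. by rewrite -(riesz_lerD2r_iff x 0) add0r subrK. Qed.

Lemma riesz_lerN2 x y : (- x <= - y) = (y <= x).
Proof. by rewrite -(riesz_subr_ge0 (- x)) opprK addrC riesz_subr_ge0. Qed.

Lemma riesz_addr_ge0 x y : 0 <= x -> 0 <= y -> 0 <= x + y.
Proof. by move=> x0 y0; rewrite -[0]addr0 riesz_lerD. Qed.

Lemma riesz_mulrn_ge0 x n : 0 <= x -> 0 <= x *+ n.
Proof.
by move=> x0; elim: n => // n IHn; rewrite mulrS riesz_addr_ge0.
Qed.

Lemma riesz_ler_scale (k : R) x y : 0 <= k -> x <= y -> k *: x <= k *: y.
Proof.
move=> k0 xy; rewrite -(riesz_subr_ge0 (k *: x)) -scalerBr.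
by rewrite riesz_scaler_ge0 ?riesz_subr_ge0.
Qed.

(** With [m] the left side, moving terms across reduces the claim to [m <= x + Order.meet x y],
    [m <= x + z] and [m <= y + z]. *)
Lemma riesz_leID x y z : 0 <= x -> 0 <= y -> 0 <= z ->
  Order.meet x (y + z) <= Order.meet x y + Order.meet x z.
Proof.
move=> x0 y0 z0; set m := Order.meet x (y + z).
have mx : m <= x by apply: leIl.
have xy0 : 0 <= Order.meet x y by rewrite lexI x0.
rewrite addrC -riesz_lerBlDr lexI riesz_lerBlDr -{1}[m]addr0 riesz_lerD//=.
rewrite riesz_lerBlDr addrC -riesz_lerBlDr lexI !riesz_lerBlDr.
by rewrite -{1}[m]addr0 riesz_lerD//= leIr.
Qed.

(** The element [x + y - z] lies below both [x] and [y], hence below their meet 0. *)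
Lemma riesz_leD_meet0 x y z :
  Order.meet x y = 0 -> x <= z -> y <= z -> x + y <= z.
Proof.
move=> xy0 xz yz; rewrite -riesz_subr_ge0 -riesz_lerN2 oppr0 opprB -xy0.
by rewrite lexI !riesz_lerBlDr riesz_lerD//= addrC riesz_lerD.
Qed.

(** Twice the modulus dominates [x + - x]; scaling by one half concludes. *)
Lemma modulus_ge0 x : 0 <= modulus x.
Proof.
have : 0 <= modulus x *+ 2.
  by rewrite mulr2n -(subrr x) riesz_lerD// ?leUl ?leUr.
move/(@riesz_scaler_ge0 _ _ 2^-1); rewrite invr_ge0 ler0n => /(_ isT).
by rewrite -scaler_nat scalerA mulVf ?pnatr_eq0// scale1r.
Qed.

Lemma modulusN x : modulus (- x) = modulus x.
Proof. by rewrite /modulus opprK joinC. Qed.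

Lemma ge0_modulus x : 0 <= x -> modulus x = x.
Proof.
move=> x0; apply/eqP; rewrite eq_le leUl leUx lexx /=.
by rewrite (le_trans _ x0)// -[0]oppr0 riesz_lerN2.
Qed.

Lemma modulus_id x : modulus (modulus x) = modulus x.
Proof. exact/ge0_modulus/modulus_ge0. Qed.

Lemma modulus_eq0 x : modulus x = 0 -> x = 0.
Proof.
move=> x0; apply/eqP; rewrite eq_le -{1}x0 leUl/= -riesz_lerN2 oppr0 -x0.
exact: leUr.
Qed.

Lemma modulus0 : modulus (0 : E) = 0.
Proof. exact: ge0_modulus. Qed.

Lemma modulusD x y : modulus (x + y) <= modulus x + modulus y.
Proof.
by rewrite leUx opprD !riesz_lerD ?leUl ?leUr.
Qed.

Lemma modulusZ_le (k : R) x : modulus (k *: x) <= `|k| *: modulus x.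
Proof.
rewrite leUx; have [k0|k0] := ger0P k.
  by rewrite -scalerN !riesz_ler_scale// ?leUl ?leUr.
rewrite -scaleNr -[k *: x]opprK -scalerN -scaleNr.
by rewrite !riesz_ler_scale ?oppr_ge0 ?leUl ?leUr// ltW.
Qed.

(** * Disjointness and linear independence *)

Lemma disjoint_sym x y : disjoint x y -> disjoint y x.
Proof. by rewrite /disjoint meetC. Qed.

Lemma disjoint_le x y z : modulus y <= modulus z -> disjoint x z -> disjoint x y.
Proof.
move=> yz xz; apply/eqP; rewrite eq_le lexI !modulus_ge0 -xz.
by rewrite lexI leIl (le_trans (leIr _ _) yz).
Qed.

Lemma disjointE x y :
  0 <= x -> 0 <= y -> disjoint x y <-> Order.meet x y = 0.
Proof. by move=> x0 y0; rewrite /disjoint !ge0_modulus. Qed.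

Lemma disjoint0 x : disjoint x 0.
Proof.
by rewrite /disjoint modulus0; apply/eqP; rewrite eq_le leIr lexI modulus_ge0/=.
Qed.

Lemma disjointD x y z : disjoint x y -> disjoint x z -> disjoint x (y + z).
Proof.
move=> xy xz; apply/eqP; rewrite eq_le lexI !modulus_ge0 !andbT.
apply: (@le_trans _ _ (Order.meet (modulus x) (modulus y + modulus z))).
  by rewrite lexI leIl (le_trans (leIr _ _) (modulusD _ _)).
by rewrite (le_trans (riesz_leID _ _ _ _ _ _)) ?modulus_ge0// xy xz addr0.
Qed.

Lemma disjointN x y : disjoint x y -> disjoint x (- y).
Proof. by rewrite /disjoint modulusN. Qed.

Lemma disjointB x y z : disjoint x y -> disjoint x z -> disjoint x (y - z).
Proof. by move=> xy /disjointN; apply: disjointD. Qed.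

Lemma disjoint_sum (I : Type) (r : seq I) (P : pred I) (F : I -> E) x :
  (forall i, P i -> disjoint x (F i)) -> disjoint x (\sum_(i <- r | P i) F i).
Proof.
move=> xF; elim/big_ind: _ => //; first exact: disjoint0.
by move=> y z; apply: disjointD.
Qed.

(** A natural number [n] bounds [k] in absolute value, and the [n]-fold sum of [modulus y] is
    disjoint from [x] by additivity. *)
Lemma disjointZ (k : R) x y : disjoint x y -> disjoint x (k *: y).
Proof.
move=> xy; pose n := Num.bound `|k|.
have xn : disjoint x (modulus y *+ n).
  rewrite -[n]card_ord -sumr_const; apply: disjoint_sum => i _.
  by rewrite /disjoint modulus_id.
apply: disjoint_le xn; rewrite [leRHS]ge0_modulus; last first.
  exact/riesz_mulrn_ge0/modulus_ge0.
rewrite (le_trans (modulusZ_le _ _))// -scaler_nat -riesz_subr_ge0 -scalerBl.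
rewrite riesz_scaler_ge0 ?modulus_ge0// subr_ge0 ltW//.
exact: archi_boundP.
Qed.

Lemma disjointxx x : disjoint x x -> x = 0.
Proof. by rewrite /disjoint meetxx => /modulus_eq0. Qed.

(** In a vanishing combination, each term is minus the sum of the others, so it is disjoint from
    itself and therefore zero. *)
Lemma disjoint_free (d : nat -> E) :
  (forall n, d n != 0) -> (forall m n, m != n -> disjoint (d m) (d n)) ->
  forall n (k : nat -> R), \sum_(i < n) k i *: d i = 0 ->
  forall i, (i < n)%N -> k i = 0.
Proof.
move=> d0 dd n k; move=> sum0 i ltin; move: sum0.
rewrite (bigD1 (Ordinal ltin))//= => /eqP; rewrite addr_eq0 => /eqP kiE.
suff /eqP : k i *: d i = 0 by rewrite scaler_eq0 (negPf (d0 i)) orbF => /eqP.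
apply: disjointxx; rewrite {2}kiE; apply/disjointN/disjoint_sum => j ji.
apply/disjointZ/disjoint_sym/disjointZ/dd.
by apply: contra_neq ji => e; apply: val_inj.
Qed.

(** * Positive and negative parts *)

Definition pos_part x := Order.join x 0.

Lemma pos_part_ge0 x : 0 <= pos_part x. Proof. exact: leUr. Qed.

Lemma pos_part_le_modulus x : pos_part x <= modulus x.
Proof. by rewrite leUx leUl modulus_ge0. Qed.

Lemma pos_partD_le x y : pos_part (x + y) <= pos_part x + pos_part y.
Proof.
by rewrite leUx riesz_lerD ?leUl// riesz_addr_ge0 ?pos_part_ge0.
Qed.

(** Both inequalities are instances of [le_pos], at [x] and at [- x]. *)
Lemma pos_partB x : pos_part x - pos_part (- x) = x.
Proof.
have le_pos y : pos_part y <= pos_part (- y) + y.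
  by rewrite leUx -!riesz_lerBlDr subrr sub0r leUr leUl.
apply/eqP; rewrite eq_le riesz_lerBlDr addrC le_pos/=.
rewrite -(riesz_lerD2r_iff (pos_part (- x)) x) subrK addrC.
by have := le_pos (- x); rewrite opprK -riesz_lerBlDr opprK.
Qed.

(** Both [x] and 0 lie below [pos_part x - m], where [m] is the meet; hence so does [pos_part x],
    which forces [m <= 0]. *)
Lemma pos_part_disjointN x : disjoint (pos_part x) (pos_part (- x)).
Proof.
apply/disjointE; rewrite ?pos_part_ge0//; set m := Order.meet _ _.
have m0 : 0 <= m by rewrite lexI !pos_part_ge0.
apply/eqP; rewrite eq_le m0 andbT.
suff : pos_part x <= pos_part x - m.
  by rewrite -(riesz_subr_ge0 (pos_part x)) addrAC subrr sub0r -{1}[0]oppr0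
    riesz_lerN2.
rewrite {1}/pos_part leUx riesz_subr_ge0 leIl andbT -{1}[x]pos_partB.
by rewrite riesz_lerD// riesz_lerN2 leIr.
Qed.

Lemma pos_part_disjoint x y : disjoint x y -> disjoint (pos_part x) (pos_part y).
Proof.
move=> xy; have posle z : modulus (pos_part z) <= modulus z.
  by rewrite ge0_modulus ?pos_part_ge0 ?pos_part_le_modulus.
apply: (disjoint_le _ _ _ (posle y)); apply/disjoint_sym.
by apply: (disjoint_le _ _ _ (posle x)); apply/disjoint_sym.
Qed.

Lemma pos_partD x y : disjoint x y -> pos_part (x + y) = pos_part x + pos_part y.
Proof.
move=> xy; apply/eqP; rewrite eq_le pos_partD_le/=.
suff posle a b : disjoint a b -> pos_part a <= pos_part (a + b).
  apply: riesz_leD_meet0.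
  - by apply/disjointE; rewrite ?pos_part_ge0//; apply: pos_part_disjoint.
  - exact: posle.
  - by rewrite addrC; apply/posle/disjoint_sym.
(* Since [a] is [(a + b) - b], its positive part is at most [pos_part (a + b) + pos_part (- b)].
   Meeting with [pos_part a] removes the second summand. *)
move=> /disjointN/pos_part_disjoint/disjointE.
rewrite !pos_part_ge0 => /(_ isT isT) ab0.
have : pos_part a <= pos_part (a + b) + pos_part (- b).
  by rewrite -{1}[a](addrK b) pos_partD_le.
move/meet_l => <-.
by rewrite (le_trans (riesz_leID _ _ _ _ _ _)) ?pos_part_ge0// ab0 addr0 leIr.
Qed.

(** * Fragments and their lattice structure *)

Lemma fragmentN x e : fragment x e -> fragment (- x) (- e).
Proof. by rewrite /fragment /disjoint -opprD !modulusN. Qed.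

Lemma fragment_compl x e : fragment x e -> fragment (e - x) e.
Proof. by rewrite /fragment subKr => /disjoint_sym. Qed.

Lemma fragment_pos_part x e : fragment x e -> fragment (pos_part x) (pos_part e).
Proof.
move=> xe; rewrite /fragment -{1}[e](subrK x) addrC pos_partD; last first.
  exact: disjoint_sym.
by rewrite addrC addrK; apply: pos_part_disjoint.
Qed.

(** The negative parts of [x] and [e - x] add up to that of [e], which is 0, so the negative part of
    [x] vanishes. *)
Lemma fragment_ge0 x e : 0 <= e -> fragment x e -> 0 <= x.
Proof.
move=> e0 /disjointN/disjoint_sym/disjointN/disjoint_sym/pos_partD.
rewrite -opprD addrC subrK => e0E; rewrite -(pos_partB x).
have xe0 : pos_part (- x) + pos_part (- (e - x)) = 0.
  by rewrite -e0E; apply: join_r; rewrite -[0]oppr0 riesz_lerN2.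
suff -> : pos_part (- x) = 0 by rewrite subr0 pos_part_ge0.
apply/eqP; rewrite eq_le pos_part_ge0 andbT -xe0 -{1}[pos_part (- x)]addr0.
by rewrite riesz_lerD ?pos_part_ge0.
Qed.

Lemma fragment_le x e : 0 <= e -> fragment x e -> x <= e.
Proof.
move=> e0 /fragment_compl/(fragment_ge0 _ _ e0).
by rewrite riesz_subr_ge0.
Qed.

Lemma fragmentE x e : 0 <= e ->
  fragment x e <-> [/\ 0 <= x, x <= e & Order.meet x (e - x) = 0].
Proof.
move=> e0; split=> [xe|[x0 xe]]; last first.
  by move/disjointE; apply=> //; rewrite riesz_subr_ge0.
have [x0 lexe] := (fragment_ge0 _ _ e0 xe, fragment_le _ _ e0 xe).
by split=> //; apply/disjointE; rewrite ?riesz_subr_ge0.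
Qed.

(** Split [z - x] as [(z - y) + (y - x)]; [x] is disjoint from [z - y] because [0 <= x <= y]. *)
Lemma fragment_trans x y z :
  0 <= z -> fragment y z -> fragment x y -> fragment x z.
Proof.
move=> z0 yz xy; have y0 := fragment_ge0 _ _ z0 yz.
have x0 := fragment_ge0 _ _ y0 xy.
rewrite /fragment -(subrKA y) addrC; apply: disjointD => //.
apply/disjoint_sym/disjoint_le/disjoint_sym/yz.
by rewrite !ge0_modulus// (fragment_le _ _ y0 xy).
Qed.

(** Here [e - x] is [(pos_part e - x) - pos_part (- e)], and [x] lies below [pos_part e], which is
    disjoint from [pos_part (- e)]. *)
Lemma fragment_of_pos_part x e : fragment x (pos_part e) -> fragment x e.
Proof.
move=> xe; have x0 := fragment_ge0 _ _ (pos_part_ge0 e) xe.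
rewrite /fragment -{1}[e]pos_partB addrAC; apply: disjointB => //.
apply/disjoint_sym/disjoint_le/disjoint_sym/pos_part_disjointN.
by rewrite !ge0_modulus ?pos_part_ge0// (fragment_le _ _ _ xe) ?pos_part_ge0.
Qed.

(** One inequality is [riesz_leID] for [c = b + (c - b)]. For the other, the two meets are disjoint
    and both lie below [x]. *)
Lemma fragment_split x b c : 0 <= c -> fragment b c -> fragment x c ->
  x = Order.meet x b + Order.meet x (c - b).
Proof.
move=> c0 bc xc; have [b0 lebc mbc] := (fragmentE _ _ c0).1 bc.
have [x0 xlec _] := (fragmentE _ _ c0).1 xc.
have cb0 : 0 <= c - b by rewrite riesz_subr_ge0.
apply/eqP; rewrite eq_le; apply/andP; split.
  by rewrite (le_trans _ (riesz_leID _ _ _ _ _ _))// addrC subrK lexI lexx.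
apply: riesz_leD_meet0; rewrite ?leIl//.
apply/eqP; rewrite eq_le !lexI x0 b0 cb0 !andbT -mbc.
by apply: leI2; apply: leIr.
Qed.

(** Splitting [b] along [x] shows that the complement of the meet in [b] is [Order.meet b (c - x)],
    which is disjoint from [x]. *)
Lemma fragment_meet x b c : 0 <= c -> fragment b c -> fragment x c ->
  fragment (Order.meet x b) b.
Proof.
move=> c0 bc xc; have b0 := fragment_ge0 _ _ c0 bc.
have [x0 xlec mxc] := (fragmentE _ _ c0).1 xc.
apply/fragmentE => //; split; rewrite ?leIr// ?lexI ?x0//.
rewrite {2}(fragment_split b x c)// [Order.meet b x]meetC addrAC subrr add0r.
have cx0 : 0 <= c - x by rewrite riesz_subr_ge0.
apply/eqP; rewrite eq_le !lexI x0 b0 cx0 !andbT -mxc.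
by apply: leI2; [apply: leIl|apply: leIr].
Qed.

(** * Disjoint sequences from infinitely many fragments *)

Lemma infinite_fragments_split b c : 0 <= c -> fragment b c ->
  infinite_set (fragments c) ->
  infinite_set (fragments b) \/ infinite_set (fragments (c - b)).
Proof.
move=> c0 bc infc; apply: contrapT => /not_orP[/contrapT finb /contrapT finc].
(* Each fragment of [c] is a sum of a fragment of [b] and one of [c - b]. *)
apply: infc; apply: sub_finite_set (finite_image2 +%R finb finc) => x xc.
exists (Order.meet x b); first exact: fragment_meet xc.
exists (Order.meet x (c - b)); last by rewrite -(fragment_split x b c).
by apply: fragment_meet xc => //; apply: fragment_compl.
Qed.

(** Some fragment [b] differs from 0 and [c], so [b] and [c - b] both differ from [c], and one of
    them keeps infinitely many fragments. *)
Lemma infinite_fragments_shrink c : 0 <= c -> infinite_set (fragments c) ->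
  exists b, [/\ fragment b c, b <> c & infinite_set (fragments b)].
Proof.
move=> c0 infc.
have [b bc [bn0 bnc]] : exists2 b, fragment b c & b <> 0 /\ b <> c.
  apply: contrapT => nb; apply: infc.
  apply: sub_finite_set (finite_set2 0 c) => b bc /=.
  by apply: contrapT => /not_orP bn; apply: nb; exists b.
have [infb|infcb] := infinite_fragments_split b c c0 bc infc; first by exists b.
exists (c - b); split=> //; first exact: fragment_compl.
by move/eqP; rewrite -subr_eq0 addrAC subrr sub0r oppr_eq0 => /eqP.
Qed.

Definition disjoint_sequence_in (A : set E) (d : nat -> E) : Prop :=
  [/\ forall n, A (d n), forall n, d n != 0 &
    forall m n, m != n -> disjoint (d m) (d n)].

(** Iterated shrinking gives a strictly decreasing chain of fragments; its consecutive differences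
    form the sequence. *)
Lemma ge0_disjoint_fragments e : 0 <= e -> infinite_set (fragments e) ->
  exists d, disjoint_sequence_in (fragments e) d.
Proof.
move=> e0 infe.
(* The conditions on [c] stand under the existential so that choice yields a total [g], with default
   value 0. *)
have /choice[g gP] c : exists b, 0 <= c -> infinite_set (fragments c) ->
    [/\ fragment b c, b <> c & infinite_set (fragments b)].
  have [[c0 infc]|nc] := pselect (0 <= c /\ infinite_set (fragments c)).
    by have [b] := infinite_fragments_shrink c c0 infc; exists b.
  by exists 0 => c0 infc; case: nc.
pose c n := iter n g e.
have cP n : [/\ 0 <= c n, fragment (c n) e & infinite_set (fragments (c n))].
  elim: n => [|n [cn0 cne /(gP _ cn0)[gc _ infgc]]].
    by split=> //; rewrite /c/= /fragment subrr; apply: disjoint0.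
  by split=> //; [apply: fragment_ge0 gc|apply: fragment_trans gc].
have cS n : fragment (c n.+1) (c n) /\ c n.+1 <> c n.
  by have [cn0 _ infc] := cP n; have [] := gP _ cn0 infc.
have c_ge0 n : 0 <= c n by have [] := cP n.
have c_le m n : (m <= n)%N -> c n <= c m.
  move=> /subnK <-; elim: (n - m)%N => // k IHk.
  rewrite addSn (le_trans _ IHk)//; apply: fragment_le => //.
  by have [] := cS (k + m)%N.
have d_ge0 n : 0 <= c n - c n.+1 by rewrite riesz_subr_ge0 c_le.
exists (fun n => c n - c n.+1); split=> [n|n|].
- apply: (fragment_trans _ (c n)) => //; first by have [] := cP n.
  by apply: fragment_compl; have [] := cS n.
- by rewrite subr_eq0; apply/eqP => cE; have [_] := cS n; rewrite cE.
(* The later difference lies below [c m.+1], a fragment of [c m] and so disjoint from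
   [c m - c m.+1]. *)
have disj m n : (m < n)%N -> disjoint (c m - c m.+1) (c n - c n.+1).
  move=> mn; have [/disjoint_sym + _] := cS m; apply: disjoint_le.
  rewrite !ge0_modulus// (le_trans _ (c_le _ _ mn))// riesz_lerBlDr.
  by rewrite -{1}[c n]addr0 riesz_lerD.
move=> m n; rewrite neq_ltn => /orP[|]; first exact: disj.
by move=> /disj/disjoint_sym.
Qed.

(** Positive and negative parts of a fragment of [e] are fragments of those of [e], so one of these
    two has infinitely many; its disjoint sequence is carried back to [e], up to sign. *)
Lemma infinite_disjoint_fragments e : infinite_set (fragments e) ->
  exists d, disjoint_sequence_in (fragments e) d.
Proof.
move=> infe; have [finp|] := pselect (finite_set (fragments (pos_part e))).
  have [finn|] := pselect (finite_set (fragments (pos_part (- e)))).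
    exfalso; apply: infe.
    apply: sub_finite_set (finite_image2 (fun x y => x - y) finp finn) => x xe.
    exists (pos_part x); first exact: fragment_pos_part.
    exists (pos_part (- x)); last exact: pos_partB.
    exact/fragment_pos_part/fragmentN.
  move=> /(ge0_disjoint_fragments _ (pos_part_ge0 _))[d [dN d0 dd]].
  exists (fun n => - d n); split=> [n|n|m n mn]; rewrite ?oppr_eq0//.
    by rewrite -[e]opprK; apply/fragmentN/fragment_of_pos_part/dN.
  by apply/disjointN/disjoint_sym/disjointN/disjoint_sym/dd.
move=> /(ge0_disjoint_fragments _ (pos_part_ge0 _))[d [dP d0 dd]].
by exists d; split=> // n; apply/fragment_of_pos_part/dP.
Qed.

Lemma finite_order_bounded (A : set E) : finite_set A -> order_bounded A.
Proof.
move=> /finite_seqP[s ->]; split.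
  elim: s => [|x s [b bs]]; first by exists 0.
  exists (Order.meet x b) => y; rewrite /= inE => /predU1P[->|/bs].
    exact: leIl.
  by apply: le_trans; apply: leIr.
elim: s => [|x s [b bs]]; first by exists 0.
exists (Order.join x b) => y; rewrite /= inE => /predU1P[->|/bs]; first exact: leUl.
by move/le_trans; apply; apply: leUr.
Qed.

End RieszTheory.

(** * Unbounded operators and the equivalence *)

Lemma OAO_unbounded (R : realType) (E F : rieszType R) (e : E) :
  archimedean F -> [set: F] <> [set 0] -> infinite_set (fragments e) ->
  exists2 T, OAO E F T & ~ laterally_to_order_bounded T.
Proof.
move=> archF F0 /infinite_disjoint_fragments[d [de d0 dd]].
have [phi [phil phid]] :=
  linear_extend_free _ _ d (fun n => n%:R) (disjoint_free _ _ d d0 dd).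
have [f f0] : exists f : F, f <> 0.
  apply: contrapT => nf; apply: F0; apply/seteqP; split=> // x _ /=.
  by apply: contrapT => x0; apply: nf; exists x.
exists (fun x => phi x *: modulus f) => [x y _|bT].
  by have := phil 1 x y; rewrite scale1r mul1r => ->; rewrite scalerDl.
(* The upper bound [b] dominates every multiple [modulus f *+ n], the value at [d n]. *)
have [_ [b bub]] := bT e; apply: f0; apply: modulus_eq0.
apply: (archF _ b) => [|n]; first exact: modulus_ge0.
by apply: bub; exists (d n) => //=; rewrite phid scaler_nat.
Qed.

Theorem theorem2p3 (R : realType) (E F : rieszType R)
    (archF : archimedean F) :
  lobOAO E F = OAO E F <->
  ([set: F] = [set 0] \/ forall e : E, finite_set (fragments e)).
Proof.
split=> [lobE|FE].
  have [F0|F0] := pselect ([set: F] = [set 0]); [by left|right=> e].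
  apply: contrapT => /(OAO_unbounded _ _ _ _ archF F0)[T OT]; apply.
  by move: OT; rewrite -lobE => -[].
apply/seteqP; split=> T; first by case.
(* In either case the image of the fragments is finite: it lies in [[set 0]], or it is the image of
   a finite set. *)
move=> OT; split=> // e; apply: finite_order_bounded.
case: FE => [F0|finE]; last exact: finite_image.
apply: sub_finite_set (finite_set1 (0 : F)) => y _.
by rewrite -F0.
Qed.
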